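(* Let $m=2$ and $\rho_1=\rho_2=\frac12$. Define real numbers $C_k,D_k$ ($k\ge0$) recursively by $$C_0=-\frac{\Delta_2}{\Delta_3},\qquad D_0=-\frac{\Delta_1}{\Delta_3},$$ $$C_{k+1}=\begin{cases}-\dfrac{\Delta_1}{\Delta_3}C_k,& k\equiv1\pmod 2,\\[2mm] \dfrac1{\Delta_3}C_{k/2}-\dfrac{\Delta_1}{\Delta_3}C_k,& k\equiv0\pmod2,\end{cases}\qquad D_{k+1}=\begin{cases}-\dfrac{\Delta_1}{\Delta_3}D_k,& k\equiv1\pmod 2,\\[2mm] D_{k/2}-\dfrac{\Delta_1}{\Delta_3}D_k,& k\equiv0\pmod2.\end{cases}$$ Then there is $\Lambda>0$ such that for all $\lambda\ge\Lambda$ $$E(\lambda)=H(\lambda)\lambda^\alpha e^\lambda+\sum_{k=0}^\infty e^{-k\lambda}\big(C_k+D_kH(\lambda)\lambda^\alpha\big),$$ and the series converges uniformly on $[\Lambda,\infty)$.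
   Context: Setting ($m=2$, $\rho_1=\rho_2=\frac12$): let $\Delta_1>0$, $\Delta_2\ge0$, $\Delta_3>0$ with $\Delta_1+\Delta_2+\Delta_3=1$. The generalized Cantor ladder is the unique continuous function $C:[0,1]\to[0,1]$ with $C(0)=0$, $C(1)=1$ such that $C(t)=\frac12C\big(\frac{t}{\Delta_1}\big)$ for $t\in[0,\Delta_1]$, $C(t)=\frac12$ for $t\in[\Delta_1,\Delta_1+\Delta_2]$, and $C(t)=\frac12+\frac12C\big(\frac{t-\Delta_1-\Delta_2}{\Delta_3}\big)$ for $t\in[\Delta_1+\Delta_2,1]$. It is monotone. (The function $C$ is not to be confused with the numbers $C_k$.) For $\lambda\ge0$ let $E(\lambda)=\int_0^1e^{\lambda C(t)}\,dt$. Put $\alpha=\log_2(\Delta_3)<0$. The function $H$: put $f(\lambda)=E(2\lambda)-\Delta_3e^{\lambda}E(\lambda)$, $f_1(\lambda)=\dfrac{f(\lambda)}{\Delta_3\lambda^\alpha e^{2\lambda}}$, and $H(\lambda)=\sum_{k\in\mathbb{Z}}f_1(2^k\lambda)$ for $\lambda>0$ (the series converges). Then $H(2\lambda)=H(\lambda)$, i.e. $H(\lambda)=\Phi(\log_2\lambda)$ with $\Phi$ $1$-periodic; equivalently, $H$ is the unique function on $(0,\infty)$ of this form such that $E(\lambda)=H(\lambda)\lambda^\alpha e^\lambda+O(1)$ as $\lambda\to\infty$. *)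

(* Defs.v *)
From Stdlib Require Import Reals ZArith Arith Lia.
From Coquelicot Require Import Coquelicot.
Open Scope R_scope.

(** The ladder is carried by a total function [C : R -> R]; only its values on
    [0, 1] are constrained. *)
Record cantor_ladder (D1 D2 D3 : R) (C : R -> R) : Prop := {
  ladder_range : forall t, 0 <= t <= 1 -> 0 <= C t <= 1;
  ladder_continuous : continuous_on (fun t => 0 <= t <= 1) C;
  ladder_0 : C 0 = 0;
  ladder_1 : C 1 = 1;
  ladder_left : forall t, 0 <= t <= D1 -> C t = / 2 * C (t / D1);
  ladder_middle : forall t, D1 <= t <= D1 + D2 -> C t = / 2;
  ladder_right : forall t, D1 + D2 <= t <= 1 ->
    C t = / 2 + / 2 * C ((t - D1 - D2) / D3)
}.

Definition E (C : R -> R) (lam : R) : R :=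
  RInt (fun t => exp (lam * C t)) 0 1.

Definition alpha (D3 : R) : R := ln D3 / ln 2.

Definition f (D3 : R) (C : R -> R) (lam : R) : R :=
  E C (2 * lam) - D3 * exp lam * E C lam.

Definition f1 (D3 : R) (C : R -> R) (lam : R) : R :=
  f D3 C lam / (D3 * Rpower lam (alpha D3) * exp (2 * lam)).

Definition SeriesZ (a : Z -> R) : R :=
  Series (fun n => a (Z.of_nat n)) + Series (fun n => a (- Z.of_nat (S n))%Z).

Definition H (D3 : R) (C : R -> R) (lam : R) : R :=
  SeriesZ (fun k => f1 D3 C (powerRZ 2 k * lam)).

(** In the even case [k - k / 2] is [k / 2], written so that the guard checker
    accepts the call; [C_coef_S] and [D_coef_S] give the intended recursion. *)
Fixpoint C_coef (D1 D2 D3 : R) (n : nat) : R :=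
  match n with
  | O => - (D2 / D3)
  | S k =>
      if Nat.even k
      then / D3 * C_coef D1 D2 D3 (k - k / 2) - D1 / D3 * C_coef D1 D2 D3 k
      else - (D1 / D3) * C_coef D1 D2 D3 k
  end.

Fixpoint D_coef (D1 D3 : R) (n : nat) : R :=
  match n with
  | O => - (D1 / D3)
  | S k =>
      if Nat.even k
      then D_coef D1 D3 (k - k / 2) - D1 / D3 * D_coef D1 D3 k
      else - (D1 / D3) * D_coef D1 D3 k
  end.

Lemma even_sub_half (k : nat) : Nat.even k = true -> (k - k / 2 = k / 2)%nat.
Proof.
  intros Hk. apply Nat.even_spec in Hk. destruct Hk as [m ->].
  rewrite (Nat.mul_comm 2 m), Nat.div_mul; lia.
Qed.

Lemma C_coef_S (D1 D2 D3 : R) (k : nat) :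
  C_coef D1 D2 D3 (S k) =
    if Nat.even k
    then / D3 * C_coef D1 D2 D3 (k / 2) - D1 / D3 * C_coef D1 D2 D3 k
    else - (D1 / D3) * C_coef D1 D2 D3 k.
Proof.
  cbn [C_coef]. destruct (Nat.even k) eqn:Hk; [|reflexivity].
  now rewrite (even_sub_half k Hk).
Qed.

Lemma D_coef_S (D1 D3 : R) (k : nat) :
  D_coef D1 D3 (S k) =
    if Nat.even k
    then D_coef D1 D3 (k / 2) - D1 / D3 * D_coef D1 D3 k
    else - (D1 / D3) * D_coef D1 D3 k.
Proof.
  cbn [D_coef]. destruct (Nat.even k) eqn:Hk; [|reflexivity].
  now rewrite (even_sub_half k Hk).
Qed.

Definition expansion_term (D1 D2 D3 : R) (C : R -> R) (lam : R) (k : nat) : R :=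
  exp (- INR k * lam) *
  (C_coef D1 D2 D3 k + D_coef D1 D3 k * (H D3 C lam * Rpower lam (alpha D3))).

(* Main.v *)
(** Put [G lam = E lam / (lam^alpha e^lam)].  Since [2^alpha = D3], each [f1 lam]
    is [G (2 lam) - G lam], so the sum defining [H] telescopes and
    [H lam = lim G (2^n lam)].  The self-similarity of the ladder gives
    [E (2 lam) = (D1 + D3 e^lam) E lam + D2 e^lam], and the recursions for [C_k] and
    [D_k] say exactly that the right-hand side of the expansion satisfies the same
    equation.  The difference [F] of the two sides then satisfies
    [F (2 lam) = (D1 + D3 e^lam) F lam]; being bounded on [[Lam, oo)], where the
    factor is at least 2, it vanishes. *)
Require Import Defs.
From Stdlib Require Import Reals Arith Lia Lra.
From Coquelicot Require Import Coquelicot.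
Open Scope R_scope.

(** * Elementary limits and geometrically dominated series *)

Lemma exp_INR_mult (n : nat) (x : R) : exp (INR n * x) = exp x ^ n.
Proof.
  induction n as [|n IH].
  - simpl. rewrite Rmult_0_l. apply exp_0.
  - rewrite S_INR. replace ((INR n + 1) * x) with (x + INR n * x) by ring.
    rewrite exp_plus, IH. reflexivity.
Qed.

Lemma exp_le_compat (x y : R) : x <= y -> exp x <= exp y.
Proof.
  intros [Hxy| ->]; [|apply Rle_refl]. left. now apply exp_increasing.
Qed.

Lemma INR_plus1_le_pow2 (n : nat) : INR n + 1 <= 2 ^ n.
Proof.
  induction n as [|n IH]; [simpl; lra|].
  rewrite S_INR. simpl. pose proof (pos_INR n). lra.
Qed.

Lemma is_series_telescope (u : nat -> R) (l : R) :
  is_lim_seq u l -> is_series (fun n => u (S n) - u n) (l - u O).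
Proof.
  intros Hu.
  change (is_lim_seq (sum_n (fun n => u (S n) - u n)) (l - u O)).
  apply (is_lim_seq_ext (fun n => u (S n) - u O)).
  - intros n. induction n as [|n IH].
    + now rewrite sum_O.
    + rewrite sum_Sn, <- IH. unfold plus; simpl. ring.
  - apply is_lim_seq_minus'; [|apply is_lim_seq_const].
    now apply (is_lim_seq_incr_1 u).
Qed.

(** The sequence is nondecreasing, and summing the increments gives the sharper bound
    [u O + 2 * M * (1 - (/ 2) ^ n)], which is the form that passes through the induction. *)
Lemma lim_geometric_increments (u : nat -> R) (M : R) :
  (forall n, 0 <= u (S n) - u n <= M * (/ 2) ^ n) ->
  exists l : R, is_lim_seq u l /\ u O <= l <= u O + 2 * M.
Proof.
  intros Hu.
  assert (HM : 0 <= M) by (specialize (Hu O); simpl in Hu; lra).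
  assert (Hlo : forall n, u O <= u n).
  { induction n as [|n IH]; [lra|]. specialize (Hu n). lra. }
  assert (Hup : forall n, u n <= u O + 2 * M).
  { assert (H1 : forall n, u n <= u O + 2 * M * (1 - (/ 2) ^ n)).
    { induction n as [|n IH]; [simpl; lra|].
      specialize (Hu n). simpl. lra. }
    intros n. specialize (H1 n).
    assert (0 < (/ 2) ^ n) by (apply pow_lt; lra).
    assert (0 <= M * (/ 2) ^ n) by (apply Rmult_le_pos; lra). lra. }
  destruct (ex_finite_lim_seq_incr u (u O + 2 * M)) as [l Hl].
  - intros n. specialize (Hu n). lra.
  - exact Hup.
  - exists l. split; [exact Hl|]. split.
    + apply (is_lim_seq_le (fun _ => u O) u (u O) l Hlo (is_lim_seq_const _) Hl).
    + apply (is_lim_seq_le u (fun _ => u O + 2 * M) l (u O + 2 * M) Hup Hl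
               (is_lim_seq_const _)).
Qed.

(** Iterating the doubling inequality gives [|F x| <= 2^-n |F (2^n x)| <= K 2^-n], and [n] is
    arbitrary. Positivity of [L] keeps every [2^n x] in the domain. *)
Lemma bounded_doubling_eq_0 (F : R -> R) (L K : R) :
  0 < L ->
  (forall x, L <= x -> 2 * Rabs (F x) <= Rabs (F (2 * x))) ->
  (forall x, L <= x -> Rabs (F x) <= K) ->
  forall x, L <= x -> F x = 0.
Proof.
  intros HL Hd HK.
  assert (Hn : forall n x, L <= x -> Rabs (F x) <= K * (/ 2) ^ n).
  { induction n as [|n IH]; intros x Hx.
    - simpl. specialize (HK x Hx). lra.
    - assert (Hx2 : L <= 2 * x) by lra.
      specialize (IH (2 * x) Hx2). specialize (Hd x Hx). simpl. lra. }
  intros x Hx.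
  assert (Hlim : is_lim_seq (fun n => K * (/ 2) ^ n) 0).
  { replace (Finite 0) with (Rbar_mult K 0) by (simpl; f_equal; ring).
    apply is_lim_seq_scal_l, is_lim_seq_geom. rewrite Rabs_pos_eq; lra. }
  pose proof (is_lim_seq_le _ _ _ _ (fun n => Hn n x Hx)
                (is_lim_seq_const _) Hlim) as H0.
  simpl in H0. pose proof (Rabs_pos (F x)).
  destruct (Req_dec (F x) 0) as [|Hne]; [assumption|].
  pose proof (Rabs_pos_lt _ Hne). lra.
Qed.

Lemma is_series_half_pow (K : R) : is_series (fun k => K * (/ 2) ^ k) (2 * K).
Proof.
  replace (2 * K) with (K * / (1 - / 2)) by field.
  exact (@is_series_scal_l R_AbsRing R_NormedModule K (fun k => (/ 2) ^ k) _
           (is_series_geom (/ 2) ltac:(rewrite Rabs_pos_eq; lra))).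
Qed.

Lemma Series_half_bound (g : nat -> R) (K : R) :
  (forall k, Rabs (g k) <= K * (/ 2) ^ k) ->
  ex_series g /\ Rabs (Series g) <= 2 * K.
Proof.
  intros Hg.
  assert (HK : ex_series (fun k => K * (/ 2) ^ k))
    by (eexists; apply is_series_half_pow).
  split.
  - now apply (@ex_series_le R_AbsRing R_CompleteNormedModule g
                 (fun k => K * (/ 2) ^ k)).
  - rewrite <- (is_series_unique _ _ (is_series_half_pow K)).
    eapply Rle_trans.
    + apply Series_Rabs.
      apply (@ex_series_le R_AbsRing R_CompleteNormedModule _
               (fun k => K * (/ 2) ^ k)); [|exact HK].
      intros k. unfold norm; simpl. unfold abs; simpl.
      rewrite Rabs_Rabsolu. apply Hg.
    + apply Series_le; [|exact HK].
      intros k. split; [apply Rabs_pos|apply Hg].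
Qed.

(** Weierstrass test with majorant [K 2^-k]. Since [sum_n] includes the index [n], the tail starts
    at [S n] and is at most [2 K 2^-(n+1)], independently of [x]. *)
Lemma CVU_dom_M_test (D : R -> Prop) (g : R -> nat -> R) (K : R) :
  (forall x k, D x -> Rabs (g x k) <= K * (/ 2) ^ k) ->
  CVU_dom (fun n x => sum_n (g x) n) D.
Proof.
  intros Hg.
  assert (Hlim : is_lim_seq (fun n => K * 2 * (/ 2) ^ S n) 0).
  { replace (Finite 0) with (Rbar_mult (K * 2) 0) by (simpl; f_equal; ring).
    apply is_lim_seq_scal_l.
    apply (is_lim_seq_incr_1 (fun n => (/ 2) ^ n)).
    apply is_lim_seq_geom. rewrite Rabs_pos_eq; lra. }
  intros eps.
  apply is_lim_seq_spec in Hlim. specialize (Hlim eps). simpl in Hlim.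
  revert Hlim. apply filter_imp. intros n Hn x Hx.
  destruct (Series_half_bound (g x) K) as [Hex _]; [intros k; now apply Hg|].
  change (Rabs (sum_n (g x) n - Series (g x)) < eps).
  rewrite (Series_incr_n (g x) (S n)) by (try lia; assumption).
  simpl pred. rewrite <- sum_n_Reals.
  replace (_ - _) with (- Series (fun k => g x (S n + k)%nat)) by ring.
  rewrite Rabs_Ropp.
  destruct (Series_half_bound (fun k => g x (S n + k)%nat) (K * (/ 2) ^ S n))
    as [_ Htail].
  { intros k. rewrite Rmult_assoc, <- pow_add. now apply Hg. }
  rewrite Rminus_0_r in Hn. pose proof (Rle_abs (K * 2 * (/ 2) ^ S n)).
  simpl in *. lra.
Qed.

(** * Dyadic recursions and their generating functions *)

(** Common shape of both coefficient recursions: [q = D1 / D3] in each, with [p = / D3] for [C_coef]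
    and [p = 1] for [D_coef]. *)
Definition dyadic_rec (p q : R) (a : nat -> R) : Prop := forall k,
  a (S k) = if Nat.even k then p * a (k / 2)%nat - q * a k else - q * a k.

(** Strong induction, because the step refers back to [k / 2]. Since [B >= 1], both [a (k / 2)] and
    [a k] are bounded by [|a O| B^k], so one step costs at most the factor [p + q <= B]. *)
Lemma dyadic_rec_bound (a : nat -> R) (p q B : R) :
  0 <= p -> 0 <= q -> dyadic_rec p q a ->
  1 <= B -> p + q <= B -> forall k, Rabs (a k) <= Rabs (a O) * B ^ k.
Proof.
  intros hp hq ha HB1 HB k.
  induction k as [k IH] using lt_wf_ind.
  destruct k as [|k]; [simpl; lra|].
  assert (Hq : Rabs (q * a k) <= q * (Rabs (a O) * B ^ k)).
  { rewrite Rabs_mult, (Rabs_pos_eq q hq).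
    apply Rmult_le_compat_l; [exact hq|]. apply IH; lia. }
  assert (Hp : Rabs (p * a (k / 2)%nat) <= p * (Rabs (a O) * B ^ k)).
  { assert (Hk : (k / 2 <= k)%nat) by (apply Nat.Div0.div_le_upper_bound; lia).
    rewrite Rabs_mult, (Rabs_pos_eq p hp).
    apply Rmult_le_compat_l; [exact hp|].
    apply Rle_trans with (Rabs (a O) * B ^ (k / 2)); [apply IH; lia|].
    apply Rmult_le_compat_l; [apply Rabs_pos|]. now apply Rle_pow. }
  assert (HX : 0 <= Rabs (a O) * B ^ k).
  { apply Rmult_le_pos; [apply Rabs_pos|]. apply pow_le; lra. }
  assert (Hs : (p + q) * (Rabs (a O) * B ^ k) <= B * (Rabs (a O) * B ^ k))
    by (now apply Rmult_le_compat_r).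
  rewrite ha. simpl pow.
  assert (Hp0 : 0 <= p * (Rabs (a O) * B ^ k)) by (now apply Rmult_le_pos).
  destruct (Nat.even k).
  - pose proof (Rabs_triang (p * a (k / 2)%nat) (- (q * a k))) as Ht.
    rewrite Rabs_Ropp in Ht. unfold Rminus. lra.
  - rewrite Ropp_mult_distr_l_reverse, Rabs_Ropp. lra.
Qed.

Lemma dyadic_rec_term_bound (a : nat -> R) (p q B x : R) :
  0 <= p -> 0 <= q -> dyadic_rec p q a ->
  1 <= B -> p + q <= B -> 0 <= x -> B * x <= / 2 ->
  forall k, Rabs (a k * x ^ k) <= Rabs (a O) * (/ 2) ^ k.
Proof.
  intros hp hq ha HB1 HB Hx HBx k.
  rewrite Rabs_mult, (Rabs_pos_eq (x ^ k)) by (now apply pow_le).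
  apply Rle_trans with (Rabs (a O) * B ^ k * x ^ k).
  - apply Rmult_le_compat_r; [now apply pow_le|]. now apply (dyadic_rec_bound a p q).
  - rewrite Rmult_assoc, <- Rpow_mult_distr.
    apply Rmult_le_compat_l; [apply Rabs_pos|].
    apply pow_incr. split; [|exact HBx]. apply Rmult_le_pos; lra.
Qed.

Lemma PSeries_dyadic_rec_bound (a : nat -> R) (p q B x : R) :
  0 <= p -> 0 <= q -> dyadic_rec p q a ->
  1 <= B -> p + q <= B -> 0 <= x -> B * x <= / 2 ->
  ex_pseries a x /\ Rabs (PSeries a x) <= 2 * Rabs (a O).
Proof.
  intros hp hq ha HB1 HB Hx HBx.
  destruct (Series_half_bound (fun k => a k * x ^ k) (Rabs (a O))) as [H1 H2].
  - now apply (dyadic_rec_term_bound a p q B).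
  - split; [now apply ex_pseries_R|exact H2].
Qed.

(** Writing [A] for the generating function, [a (k / 2)] at even [k] and 0 at odd [k] are the
    coefficients of [A (x^2)] as a series in [x]; this is the sequence [b] below. Hence the
    recursion reads [A x = a O + x (p A (x^2) - q A x)]. *)
Lemma PSeries_dyadic_rec (a : nat -> R) (p q B x : R) :
  0 <= p -> 0 <= q -> dyadic_rec p q a ->
  1 <= B -> p + q <= B -> 0 <= x -> B * x <= / 2 ->
  PSeries a x = a O + p * x * PSeries a (x ^ 2) - q * x * PSeries a x.
Proof.
  intros hp hq ha HB1 HB Hx HBx.
  (* As [B >= 1], the hypothesis on [B * x] forces [x <= 1/2], so [x^2 <= x] and the convergence
     criterion also holds at [x^2]. *)
  assert (Hx1 : x <= / 2) by nra.
  assert (HBx2 : B * x ^ 2 <= / 2) by nra.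
  assert (Hx2 : 0 <= x ^ 2) by (now apply pow_le).
  assert (Ha : ex_pseries a x)
    by (now apply (PSeries_dyadic_rec_bound a p q B)).
  assert (Ha2 : ex_pseries a (x ^ 2))
    by (now apply (PSeries_dyadic_rec_bound a p q B)).
  set (b := fun k => if Nat.even k then a (k / 2)%nat else 0).
  assert (Hb : is_pseries b x (PSeries a (x ^ 2))).
  { replace (PSeries a (x ^ 2)) with (PSeries a (x ^ 2) + x * 0) by ring.
    apply is_pseries_odd_even.
    - apply (is_pseries_ext a); [|now apply PSeries_correct].
      intros k. unfold b.
      rewrite Nat.even_mul, (Nat.mul_comm 2 k), Nat.div_mul by lia. reflexivity.
    - apply (is_pseries_ext (fun _ => 0)).
      + intros k. unfold b. rewrite Nat.even_add, Nat.even_mul. reflexivity.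
      + apply is_pseries_R.
        apply (is_series_ext (fun n => 0 * (/ 2) ^ n)).
        { intros n. now rewrite !Rmult_0_l. }
        pose proof (is_series_half_pow 0) as H0.
        now rewrite Rmult_0_r in H0. }
  rewrite (PSeries_decr_1 a x Ha) at 1.
  rewrite (PSeries_ext _ (PS_plus (PS_scal p b) (PS_scal (- q) a))).
  - rewrite PSeries_plus.
    + rewrite !PSeries_scal, (is_pseries_unique _ _ _ Hb). ring.
    + apply ex_pseries_scal; [apply Rmult_comm|]. eexists; exact Hb.
    + apply ex_pseries_scal; [apply Rmult_comm|exact Ha].
  - intros k. unfold PS_decr_1, PS_plus, PS_scal, b. rewrite ha.
    unfold plus, scal; simpl. unfold mult; simpl.
    destruct (Nat.even k); ring.
Qed.

(** * Integrability and the functional equation of [E] *)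

(** The clamp onto [[a, b]] is 1-Lipschitz and lands in [[a, b]], so continuity relative to the
    interval suffices. This turns the ladder, unconstrained outside [[0, 1]], into an integrand that
    is continuous at the endpoints from both sides. *)
Lemma continuous_on_clamp (g : R -> R) (a b : R) :
  a <= b -> continuous_on (fun t => a <= t <= b) g ->
  forall x, continuous (fun t => g (Rmax a (Rmin b t))) x.
Proof.
  intros Hab Hg x.
  assert (Hin : forall t, a <= Rmax a (Rmin b t) <= b).
  { intros t. split; [apply Rmax_l|].
    apply Rmax_lub; [exact Hab|apply Rmin_l]. }
  refine (filterlim_comp _ _ _ _ _ _ _ _ _ (Hg _ (Hin x))).
  intros P HP. unfold within in HP.
  assert (Hc : continuous (fun t => Rmax a (Rmin b t)) x).
  { apply filterlim_locally. intros eps. exists eps. intros t.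
    unfold ball; simpl; unfold AbsRing_ball, abs, minus, plus, opp; simpl.
    apply Rle_lt_trans. unfold Rmax, Rmin, Rabs.
    repeat destruct Rle_dec; repeat destruct Rcase_abs; lra. }
  specialize (Hc _ HP). unfold filtermap in *.
  revert Hc. apply filter_imp. intros t Ht. apply Ht, Hin.
Qed.

Lemma ladder_ex_RInt (D1 D2 D3 : R) (C : R -> R) (lam : R) :
  cantor_ladder D1 D2 D3 C -> ex_RInt (fun t => exp (lam * C t)) 0 1.
Proof.
  intros hC.
  apply (ex_RInt_ext (fun t => exp (lam * C (Rmax 0 (Rmin 1 t))))).
  - rewrite Rmin_left, Rmax_right by lra. intros x Hx.
    now rewrite (Rmin_right 1 x), (Rmax_right 0 x) by lra.
  - apply (@ex_RInt_continuous R_CompleteNormedModule). intros z _.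
    apply (continuous_comp (fun t => lam * C (Rmax 0 (Rmin 1 t))) exp).
    + apply (continuous_scal_r (K := R_AbsRing) (V := R_NormedModule) lam).
      apply continuous_on_clamp; [lra|]. exact (ladder_continuous _ _ _ _ hC).
    + apply continuity_pt_filterlim, derivable_continuous_pt, derivable_pt_exp.
Qed.

(** Split the integral at [D1] and [D1 + D2]. Affine substitution maps each outer piece onto
    [[0, 1]]; the factor [1/2] in the self-similarity cancels the 2 in [2 * lam], and the offset
    [1/2] on the right piece produces [exp lam]. *)
Lemma E_scaling (D1 D2 D3 : R) (C : R -> R) (lam : R) :
  0 < D1 -> 0 <= D2 -> 0 < D3 -> D1 + D2 + D3 = 1 ->
  cantor_ladder D1 D2 D3 C ->
  E C (2 * lam) = (D1 + D3 * exp lam) * E C lam + D2 * exp lam.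
Proof.
  intros hD1 hD2 hD3 hD hC.
  pose proof (ladder_ex_RInt D1 D2 D3 C (2 * lam) hC) as Hex.
  pose proof (ladder_ex_RInt D1 D2 D3 C lam hC) as Hex1.
  set (g := fun t => exp (2 * lam * C t)) in *.
  set (g1 := fun t => exp (lam * C t)) in *.
  assert (Hex_l : ex_RInt g 0 D1)
    by (apply (ex_RInt_Chasles_1 g 0 D1 1); [lra|exact Hex]).
  assert (Hex_r : ex_RInt g D1 1)
    by (apply (ex_RInt_Chasles_2 g 0 D1 1); [lra|exact Hex]).
  assert (Hex_m : ex_RInt g D1 (D1 + D2))
    by (apply (ex_RInt_Chasles_1 g D1 (D1 + D2) 1); [lra|exact Hex_r]).
  assert (Hex_r2 : ex_RInt g (D1 + D2) 1)
    by (apply (ex_RInt_Chasles_2 g D1 (D1 + D2) 1); [lra|exact Hex_r]).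
  assert (Hl : RInt g 0 D1 = D1 * E C lam).
  { pose proof (RInt_comp_lin g1 (/ D1) 0 0 D1) as Hs.
    replace (/ D1 * 0 + 0) with 0 in Hs by ring.
    replace (/ D1 * D1 + 0) with 1 in Hs by (field; lra).
    specialize (Hs Hex1). unfold E. fold g1. rewrite <- Hs.
    rewrite <- (RInt_scal (V := R_CompleteNormedModule) _ _ _ D1).
    - apply RInt_ext. rewrite Rmin_left, Rmax_right by lra. intros x Hx.
      unfold g, g1, scal; simpl; unfold mult; simpl.
      rewrite (ladder_left _ _ _ _ hC x) by lra.
      replace (/ D1 * x + 0) with (x / D1) by (field; lra).
      replace (2 * lam * (/ 2 * C (x / D1))) with (lam * C (x / D1)) by field.
      field. lra.
    - apply (ex_RInt_comp_lin g1 (/ D1) 0).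
      replace (/ D1 * 0 + 0) with 0 by ring.
      now replace (/ D1 * D1 + 0) with 1 by (field; lra). }
  assert (Hm : RInt g D1 (D1 + D2) = D2 * exp lam).
  { rewrite (RInt_ext _ (fun _ => exp lam)).
    - rewrite RInt_const. unfold scal; simpl; unfold mult; simpl. ring.
    - rewrite Rmin_left, Rmax_right by lra. intros x Hx. unfold g.
      rewrite (ladder_middle _ _ _ _ hC x) by lra. f_equal. field. }
  assert (Hr : RInt g (D1 + D2) 1 = D3 * exp lam * E C lam).
  { pose proof (RInt_comp_lin g1 (/ D3) (- (D1 + D2) / D3) (D1 + D2) 1) as Hs.
    replace (/ D3 * (D1 + D2) + - (D1 + D2) / D3) with 0 in Hs by (field; lra).
    replace (/ D3 * 1 + - (D1 + D2) / D3) with 1 in Hs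
      by (replace (D1 + D2) with (1 - D3) by lra; field; lra).
    specialize (Hs Hex1). unfold E. fold g1. rewrite <- Hs.
    rewrite <- (RInt_scal (V := R_CompleteNormedModule) _ _ _ (D3 * exp lam)).
    - apply RInt_ext. rewrite Rmin_left, Rmax_right by lra. intros x Hx.
      unfold g, g1, scal; simpl; unfold mult; simpl.
      rewrite (ladder_right _ _ _ _ hC x) by lra.
      replace (/ D3 * x + - (D1 + D2) / D3) with ((x - D1 - D2) / D3)
        by (field; lra).
      set (c := C ((x - D1 - D2) / D3)).
      replace (2 * lam * (/ 2 + / 2 * c)) with (lam + lam * c) by field.
      rewrite exp_plus. field. lra.
    - apply (ex_RInt_comp_lin g1 (/ D3) (- (D1 + D2) / D3)).
      replace (/ D3 * (D1 + D2) + - (D1 + D2) / D3) with 0 by (field; lra).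
      replace (/ D3 * 1 + - (D1 + D2) / D3) with 1; [exact Hex1|].
      replace (D1 + D2) with (1 - D3) by lra. field. lra. }
  unfold E at 1. fold g.
  rewrite <- (RInt_Chasles g 0 D1 1 Hex_l Hex_r).
  rewrite <- (RInt_Chasles g D1 (D1 + D2) 1 Hex_m Hex_r2).
  rewrite Hl, Hm, Hr. unfold plus; simpl. ring.
Qed.

Lemma E_bounds (D1 D2 D3 : R) (C : R -> R) (lam : R) :
  cantor_ladder D1 D2 D3 C -> 0 <= lam -> 0 <= E C lam <= exp lam.
Proof.
  intros hC Hlam.
  pose proof (ladder_ex_RInt D1 D2 D3 C lam hC) as Hex.
  unfold E. split.
  - apply RInt_ge_0; [lra|exact Hex|]. intros x _. left. apply exp_pos.
  - replace (exp lam) with (RInt (fun _ => exp lam) 0 1).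
    + apply RInt_le; [lra|exact Hex|apply ex_RInt_const|].
      intros x Hx. destruct (ladder_range _ _ _ _ hC x) as [H0 H1]; [lra|].
      apply exp_le_compat. nra.
    + rewrite RInt_const. unfold scal; simpl; unfold mult; simpl. ring.
Qed.

(** * Telescoping of [H] and size of the leading term *)

Definition G (D3 : R) (C : R -> R) (lam : R) : R :=
  E C lam / (Rpower lam (alpha D3) * exp lam).

Lemma Rpower_alpha_double (D3 lam : R) :
  0 < D3 -> 0 < lam ->
  Rpower (2 * lam) (alpha D3) = D3 * Rpower lam (alpha D3).
Proof.
  intros hD3 Hlam. rewrite <- Rpower_mult_distr by lra. f_equal.
  unfold Rpower, alpha.
  replace (ln D3 / ln 2 * ln 2) with (ln D3) by (field; apply ln_neq_0; lra).
  now apply exp_ln.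
Qed.

Lemma Rpower_alpha_pow2 (D3 lam : R) (n : nat) :
  0 < D3 -> 0 < lam ->
  Rpower (2 ^ n * lam) (alpha D3) = D3 ^ n * Rpower lam (alpha D3).
Proof.
  intros hD3 Hlam. induction n as [|n IH]; simpl.
  - now rewrite !Rmult_1_l.
  - rewrite Rmult_assoc, Rpower_alpha_double, IH; [ring|lra|].
    apply Rmult_lt_0_compat; [apply pow_lt|]; lra.
Qed.

Lemma f1_telescope (D3 : R) (C : R -> R) (lam : R) :
  0 < D3 -> 0 < lam -> f1 D3 C lam = G D3 C (2 * lam) - G D3 C lam.
Proof.
  intros hD3 Hlam. unfold f1, Defs.f, G. rewrite Rpower_alpha_double by assumption.
  assert (HP : 0 < Rpower lam (alpha D3)) by apply exp_pos.
  pose proof (exp_pos lam) as He.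
  replace (2 * lam) with (lam + lam) by ring. rewrite exp_plus.
  field. lra.
Qed.

(** Follows from [0 <= E <= exp lam]. For [D3 < 1] the exponent [alpha] is negative, so the upper
    bound tends to 0 as [lam] tends to 0; this controls the negative half of the sum over the
    integers. *)
Lemma G_bounds (D1 D2 D3 : R) (C : R -> R) (lam : R) :
  cantor_ladder D1 D2 D3 C -> 0 < lam ->
  0 <= G D3 C lam <= / Rpower lam (alpha D3).
Proof.
  intros hC Hlam.
  destruct (E_bounds D1 D2 D3 C lam hC (Rlt_le _ _ Hlam)) as [H0 H1].
  assert (HP : 0 < Rpower lam (alpha D3)) by apply exp_pos.
  pose proof (exp_pos lam) as He.
  assert (HPe : 0 < Rpower lam (alpha D3) * exp lam)
    by (now apply Rmult_lt_0_compat).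
  unfold G. split.
  - now apply Rdiv_le_0_compat.
  - apply Rle_div_l; [exact HPe|].
    replace (/ Rpower lam (alpha D3) * (Rpower lam (alpha D3) * exp lam))
      with (exp lam) by (field; lra).
    exact H1.
Qed.

(** Both halves of the sum telescope: the nonnegative indices give [l - G lam], the negative ones
    [G lam - 0]. *)
Lemma H_lim (D1 D2 D3 : R) (C : R -> R) (lam l : R) :
  0 < D3 < 1 -> cantor_ladder D1 D2 D3 C -> 0 < lam ->
  is_lim_seq (fun n => G D3 C (2 ^ n * lam)) l -> H D3 C lam = l.
Proof.
  intros [hD3 hD3'] hC Hlam Hl.
  assert (Hpos : forall n, 0 < 2 ^ n * lam).
  { intros n. apply Rmult_lt_0_compat; [apply pow_lt|]; lra. }
  assert (Hneg : forall n, 0 < / 2 ^ n * lam).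
  { intros n. apply Rmult_lt_0_compat; [|exact Hlam].
    apply Rinv_0_lt_compat, pow_lt; lra. }
  (* Halving the argument multiplies [lam^-alpha] by [D3], so [G (2^-n lam) <= D3^n / lam^alpha],
     which vanishes in the limit because [D3 < 1]. *)
  assert (Hv : is_lim_seq (fun n => - G D3 C (/ 2 ^ n * lam)) 0).
  { replace (Finite 0) with (Rbar_opp 0) by (simpl; f_equal; ring).
    apply -> is_lim_seq_opp.
    assert (Hg : is_lim_seq (fun n => / Rpower lam (alpha D3) * D3 ^ n) 0).
    { replace (Finite 0) with (Rbar_mult (/ Rpower lam (alpha D3)) 0)
        by (simpl; f_equal; ring).
      apply is_lim_seq_scal_l, is_lim_seq_geom. rewrite Rabs_pos_eq; lra. }
    refine (is_lim_seq_le_le (fun _ => 0) _ _ _ _ (is_lim_seq_const 0) Hg).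
    intros n.
    destruct (G_bounds D1 D2 D3 C _ hC (Hneg n)) as [H0 H1].
    split; [exact H0|]. eapply Rle_trans; [exact H1|]. right.
    replace (Rpower lam (alpha D3))
      with (D3 ^ n * Rpower (/ 2 ^ n * lam) (alpha D3)).
    - field. split; [|apply pow_nonzero; lra].
      apply Rgt_not_eq, exp_pos.
    - rewrite <- Rpower_alpha_pow2 by auto. f_equal. field.
      apply pow_nonzero; lra. }
  unfold H, SeriesZ.
  rewrite (Series_ext _ (fun n => G D3 C (2 ^ S n * lam) - G D3 C (2 ^ n * lam))).
  2:{ intros n. rewrite <- pow_powerRZ, f1_telescope by auto.
      simpl pow. now rewrite <- Rmult_assoc. }
  rewrite (Series_ext (fun n => f1 D3 C (powerRZ 2 (- Z.of_nat (S n)) * lam))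
    (fun n => - G D3 C (/ 2 ^ S n * lam) - - G D3 C (/ 2 ^ n * lam))).
  2:{ intros n. rewrite powerRZ_neg', <- pow_powerRZ, f1_telescope by auto.
      replace (2 * (/ 2 ^ S n * lam)) with (/ 2 ^ n * lam); [ring|].
      simpl. field. apply pow_nonzero; lra. }
  rewrite (is_series_unique _ _
    (is_series_telescope (fun n => G D3 C (2 ^ n * lam)) l Hl)).
  rewrite (is_series_unique _ _
    (is_series_telescope (fun n => - G D3 C (/ 2 ^ n * lam)) 0 Hv)).
  simpl. rewrite Rinv_1. ring.
Qed.

(** By the functional equation the numerator of [f1] is [D1 E + D2 e^lam], which lies between 0 and
    [(D1 + D2) e^lam <= e^lam]. *)
Lemma G_increment_bound (D1 D2 D3 : R) (C : R -> R) (lam : R) :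
  0 < D1 -> 0 <= D2 -> 0 < D3 -> D1 + D2 + D3 = 1 ->
  cantor_ladder D1 D2 D3 C -> 0 < lam ->
  0 <= G D3 C (2 * lam) - G D3 C lam
    <= / (D3 * Rpower lam (alpha D3) * exp lam).
Proof.
  intros hD1 hD2 hD3 hD hC Hlam.
  destruct (E_bounds D1 D2 D3 C lam hC (Rlt_le _ _ Hlam)) as [H0 H1].
  rewrite <- f1_telescope by assumption. unfold f1, Defs.f.
  rewrite (E_scaling D1 D2 D3) by assumption.
  replace (2 * lam) with (lam + lam) by ring. rewrite exp_plus.
  assert (HP : 0 < Rpower lam (alpha D3)) by apply exp_pos.
  pose proof (exp_pos lam) as He.
  set (P := Rpower lam (alpha D3)) in *. set (e := exp lam) in *.
  assert (Hden : 0 < D3 * P * (e * e)) by (repeat apply Rmult_lt_0_compat; lra).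
  replace ((D1 + D3 * e) * E C lam + D2 * e - D3 * e * E C lam)
    with (D1 * E C lam + D2 * e) by ring.
  split.
  - apply Rdiv_le_0_compat; [|exact Hden]. nra.
  - apply Rle_div_l; [exact Hden|].
    replace (/ (D3 * P * e) * (D3 * P * (e * e))) with e by (field; lra).
    nra.
Qed.

(** Along [2^n lam] the increments of [G] are dominated by a geometric sequence of ratio [1/2]: from
    [n + 1 <= 2^n] one gets [exp (2^n lam) >= e^lam (e^lam)^n], and [(D3 e^lam)^n >= 2^n] absorbs
    the factor [D3^n] coming from the power of [lam]. *)
Lemma H_bounds (D1 D2 D3 : R) (C : R -> R) (lam : R) :
  0 < D1 -> 0 <= D2 -> 0 < D3 -> D1 + D2 + D3 = 1 ->
  cantor_ladder D1 D2 D3 C -> 0 < lam -> 2 <= D3 * exp lam ->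
  is_lim_seq (fun n => G D3 C (2 ^ n * lam)) (H D3 C lam) /\
  G D3 C lam <= H D3 C lam
    <= G D3 C lam + 2 * / (D3 * Rpower lam (alpha D3) * exp lam).
Proof.
  intros hD1 hD2 hD3 hD hC Hlam He2.
  pose proof (exp_pos lam) as He.
  assert (HP : 0 < Rpower lam (alpha D3)) by apply exp_pos.
  destruct (lim_geometric_increments (fun n => G D3 C (2 ^ n * lam))
    (/ (D3 * Rpower lam (alpha D3) * exp lam))) as [l [Hl Hb]].
  - intros n.
    assert (Hn : 0 < 2 ^ n * lam)
      by (apply Rmult_lt_0_compat; [apply pow_lt|]; lra).
    destruct (G_increment_bound D1 D2 D3 C _ hD1 hD2 hD3 hD hC Hn) as [H0 H1].
    replace (2 ^ S n * lam) with (2 * (2 ^ n * lam)) by (simpl; ring).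
    split; [exact H0|]. eapply Rle_trans; [exact H1|].
    rewrite Rpower_alpha_pow2, pow_inv, <- Rinv_mult by assumption.
    apply Rinv_le_contravar.
    + apply Rmult_lt_0_compat; [|apply pow_lt; lra].
      repeat apply Rmult_lt_0_compat; lra.
    + assert (Hexp : exp lam * exp lam ^ n <= exp (2 ^ n * lam)).
      { rewrite <- exp_INR_mult, <- exp_plus. apply exp_le_compat.
        pose proof (INR_plus1_le_pow2 n). nra. }
      assert (Hpow : 2 ^ n <= D3 ^ n * exp lam ^ n).
      { rewrite <- Rpow_mult_distr. apply pow_incr; lra. }
      assert (HD : 0 < D3 ^ n) by (apply pow_lt; lra).
      apply Rle_trans with
        (D3 * Rpower lam (alpha D3) * exp lam * (D3 ^ n * exp lam ^ n)).
      * apply Rmult_le_compat_l; [|exact Hpow].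
        left. repeat apply Rmult_lt_0_compat; lra.
      * replace (D3 * Rpower lam (alpha D3) * exp lam * (D3 ^ n * exp lam ^ n))
          with (D3 * (D3 ^ n * Rpower lam (alpha D3)) * (exp lam * exp lam ^ n))
          by ring.
        apply Rmult_le_compat_l; [|exact Hexp].
        left. repeat apply Rmult_lt_0_compat; lra.
  - assert (hD3' : 0 < D3 < 1) by lra.
    rewrite (H_lim D1 D2 D3 C lam l hD3' hC Hlam Hl).
    simpl in Hb. rewrite Rmult_1_l in Hb. now split.
Qed.

(* The expansion has the form [e^lam h + c (e^-lam) + d (e^-lam) h] with [c], [d]
   the generating functions of [C_k], [D_k]. *)
Definition h (D3 : R) (C : R -> R) (lam : R) : R :=
  H D3 C lam * Rpower lam (alpha D3).

(** [H (2 lam) = H lam], since the sequence defining the former is a shift of the one defining the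
    latter; the power contributes [2^alpha = D3]. *)
Lemma h_double (D1 D2 D3 : R) (C : R -> R) (lam : R) :
  0 < D1 -> 0 <= D2 -> 0 < D3 -> D1 + D2 + D3 = 1 ->
  cantor_ladder D1 D2 D3 C -> 0 < lam -> 2 <= D3 * exp lam ->
  h D3 C (2 * lam) = D3 * h D3 C lam.
Proof.
  intros hD1 hD2 hD3 hD hC Hlam He2. unfold h.
  rewrite Rpower_alpha_double by assumption.
  destruct (H_bounds D1 D2 D3 C lam) as [Hl _]; try assumption.
  rewrite (H_lim D1 D2 D3 C (2 * lam) (H D3 C lam)); [ring|lra|exact hC|lra|].
  apply (is_lim_seq_ext (fun n => G D3 C (2 ^ S n * lam))).
  - intros n. f_equal. simpl. ring.
  - now apply (is_lim_seq_incr_1 (fun n => G D3 C (2 ^ n * lam))).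
Qed.

(** The bounds on [H], multiplied by [lam^alpha e^lam], leave an error of at most [2 / D3]. As [E]
    and [2 / D3] are both at most [e^lam], it follows that [h <= 2]. *)
Lemma h_bounds (D1 D2 D3 : R) (C : R -> R) (lam : R) :
  0 < D1 -> 0 <= D2 -> 0 < D3 -> D1 + D2 + D3 = 1 ->
  cantor_ladder D1 D2 D3 C -> 0 < lam -> 2 <= D3 * exp lam ->
  E C lam <= h D3 C lam * exp lam <= E C lam + 2 / D3 /\
  0 <= h D3 C lam <= 2.
Proof.
  intros hD1 hD2 hD3 hD hC Hlam He2.
  destruct (H_bounds D1 D2 D3 C lam) as [_ [H0 H1]]; try assumption.
  destruct (E_bounds D1 D2 D3 C lam hC (Rlt_le _ _ Hlam)) as [HE0 HE1].
  pose proof (exp_pos lam) as He.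
  assert (HP : 0 < Rpower lam (alpha D3)) by apply exp_pos.
  assert (HPe : 0 < Rpower lam (alpha D3) * exp lam)
    by (now apply Rmult_lt_0_compat).
  assert (HG : G D3 C lam * (Rpower lam (alpha D3) * exp lam) = E C lam)
    by (unfold G; field; lra).
  assert (Hh : E C lam <= h D3 C lam * exp lam <= E C lam + 2 / D3).
  { unfold h. rewrite Rmult_assoc. split.
    - rewrite <- HG. apply Rmult_le_compat_r; lra.
    - apply Rle_trans with
        ((G D3 C lam + 2 * / (D3 * Rpower lam (alpha D3) * exp lam))
         * (Rpower lam (alpha D3) * exp lam)).
      + apply Rmult_le_compat_r; lra.
      + right. rewrite Rmult_plus_distr_r, HG. field. lra. }
  split; [exact Hh|].
  assert (Hd : 2 / D3 <= exp lam) by (apply Rle_div_l; lra).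
  split.
  - apply Rmult_le_reg_r with (exp lam); lra.
  - apply Rmult_le_reg_r with (exp lam); lra.
Qed.

(** * The exact expansion and its uniform convergence *)

Lemma C_coef_rec (D1 D2 D3 : R) :
  dyadic_rec (/ D3) (D1 / D3) (C_coef D1 D2 D3).
Proof. intros k. apply C_coef_S. Qed.

Lemma D_coef_rec (D1 D3 : R) : dyadic_rec 1 (D1 / D3) (D_coef D1 D3).
Proof. intros k. rewrite Rmult_1_l. apply D_coef_S. Qed.

Theorem theorem2 (D1 D2 D3 : R) (C : R -> R)
  (hD1 : 0 < D1) (hD2 : 0 <= D2) (hD3 : 0 < D3) (hD : D1 + D2 + D3 = 1)
  (hC : cantor_ladder D1 D2 D3 C) :
  exists Lam : R, 0 < Lam /\
    (forall lam : R, Lam <= lam ->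
       E C lam = H D3 C lam * Rpower lam (alpha D3) * exp lam
                 + Series (fun k => expansion_term D1 D2 D3 C lam k)) /\
    CVU_dom (fun n lam => sum_n (fun k => expansion_term D1 D2 D3 C lam k) n)
            (fun lam => Lam <= lam).
Proof.
  (* One growth rate for both coefficient sequences: it is [p + q] for [C_coef], and it exceeds
     [p + q] for [D_coef] because [1 / D3 > 1]. *)
  set (B := / D3 + D1 / D3).
  assert (HiD3 : 1 < / D3) by (rewrite <- Rinv_1; apply Rinv_lt_contravar; lra).
  assert (Hq : 0 < D1 / D3) by (apply Rdiv_lt_0_compat; lra).
  assert (HB1 : 1 <= B) by (unfold B; lra).
  assert (HBD : 1 <= D3 * B).
  { unfold B. replace (D3 * (/ D3 + D1 / D3)) with (1 + D1) by (field; lra). lra. }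
  assert (HBC : / D3 + D1 / D3 <= B) by (unfold B; lra).
  assert (HB2 : 1 + D1 / D3 <= B) by (unfold B; lra).
  pose proof (C_coef_rec D1 D2 D3) as HCr.
  pose proof (D_coef_rec D1 D3) as HDr.
  set (c := C_coef D1 D2 D3) in *. set (d := D_coef D1 D3) in *.
  assert (Hip : 0 <= / D3) by lra. assert (Hq0 : 0 <= D1 / D3) by lra.
  (* From here on [e^lam >= 2 B]: the coefficient series in [e^-lam] are dominated with ratio [1/2],
     and [D3 e^lam >= 2 (1 + D1) >= 2]. *)
  exists (ln (2 * B)).
  assert (HL0 : 0 < ln (2 * B)) by (rewrite <- ln_1; apply ln_increasing; lra).
  assert (HL : forall lam, ln (2 * B) <= lam ->
    0 < lam /\ 2 <= D3 * exp lam /\ 0 <= exp (- lam) /\ B * exp (- lam) <= / 2).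
  { intros lam Hlam.
    assert (He : 2 * B <= exp lam).
    { rewrite <- (exp_ln (2 * B)) by lra. now apply exp_le_compat. }
    rewrite exp_Ropp. pose proof (exp_pos lam) as Hp.
    repeat split.
    - lra.
    - nra.
    - left. now apply Rinv_0_lt_compat.
    - apply Rmult_le_reg_r with (exp lam); [exact Hp|].
      rewrite Rmult_assoc, Rinv_l; lra. }
  assert (Hterm : forall lam k, expansion_term D1 D2 D3 C lam k
    = c k * exp (- lam) ^ k + h D3 C lam * (d k * exp (- lam) ^ k)).
  { intros lam k. unfold expansion_term. fold c d.
    replace (- INR k * lam) with (INR k * - lam) by ring.
    rewrite exp_INR_mult. unfold h. ring. }
  assert (HS : forall lam, ln (2 * B) <= lam ->
    Series (fun k => expansion_term D1 D2 D3 C lam k)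
    = PSeries c (exp (- lam)) + h D3 C lam * PSeries d (exp (- lam))).
  { intros lam Hlam. destruct (HL lam Hlam) as (_ & _ & Hx & HBx).
    destruct (PSeries_dyadic_rec_bound c _ _ B (exp (- lam)) Hip Hq0 HCr) as [Hc _];
      try assumption.
    destruct (PSeries_dyadic_rec_bound d _ _ B (exp (- lam)) Rle_0_1 Hq0 HDr) as [Hd _];
      try assumption.
    apply ex_pseries_R in Hc. apply ex_pseries_R in Hd.
    rewrite (Series_ext (fun k => expansion_term D1 D2 D3 C lam k) _ (Hterm lam)).
    rewrite Series_plus, Series_scal_l; [reflexivity|exact Hc|].
    exact (@ex_series_scal_l R_AbsRing R_NormedModule (h D3 C lam) _ Hd). }
  split; [exact HL0|]. split.
  - set (F := fun lam => E C lam - h D3 C lam * exp lam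
      - (PSeries c (exp (- lam)) + h D3 C lam * PSeries d (exp (- lam)))).
    assert (HF : forall lam, ln (2 * B) <= lam -> F lam = 0).
    (* The bound on [F] adds [2 / D3] for [E - h e^lam], [2 |c O|] for the series of [c], and
       [2 |d O|] for that of [d], multiplied by [h <= 2]. *)
    { apply (bounded_doubling_eq_0 F _
        (2 / D3 + (2 * Rabs (c O) + 2 * (2 * Rabs (d O))))); [exact HL0| |].
      - intros lam Hlam. destruct (HL lam Hlam) as (Hpos & He2 & Hx & HBx).
        (* Each piece satisfies the homogeneous equation up to a remainder. The remainder [D2 e^lam]
           of [E] cancels against that of [c]. Since [h (2 lam) e^(2 lam) = D3 h e^(2 lam)] falls
           short of [(D1 + D3 e^lam) h e^lam] by [D1 h e^lam], the remainder of [h d] makes up the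
           difference. *)
        assert (HF2 : F (2 * lam) = (D1 + D3 * exp lam) * F lam).
        { unfold F. rewrite (E_scaling D1 D2 D3), (h_double D1 D2 D3) by assumption.
          pose proof (exp_pos lam) as He.
          assert (Hx2 : exp (- (2 * lam)) = exp (- lam) ^ 2)
            by (simpl; rewrite Rmult_1_r, <- exp_plus; f_equal; ring).
          rewrite Hx2.
          assert (HdC : PSeries c (exp (- lam) ^ 2)
            = (D1 + D3 * exp lam) * PSeries c (exp (- lam)) + D2 * exp lam).
          { pose proof (PSeries_dyadic_rec c _ _ B (exp (- lam))
              Hip Hq0 HCr HB1 HBC Hx HBx) as Hrec.
            change (c O) with (- (D2 / D3)) in Hrec.
            set (y := PSeries c (exp (- lam))) in *.
            set (z := PSeries c (exp (- lam) ^ 2)) in *.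
            rewrite exp_Ropp in Hrec.
            transitivity (D3 * exp lam * (/ D3 * / exp lam * z)); [field; lra|].
            replace (/ D3 * / exp lam * z)
              with (y - - (D2 / D3) + D1 / D3 * / exp lam * y) by lra.
            field. lra. }
          assert (HdD : D3 * PSeries d (exp (- lam) ^ 2)
            = D1 * exp lam + (D1 + D3 * exp lam) * PSeries d (exp (- lam))).
          { pose proof (PSeries_dyadic_rec d _ _ B (exp (- lam))
              Rle_0_1 Hq0 HDr HB1 HB2 Hx HBx) as Hrec.
            change (d O) with (- (D1 / D3)) in Hrec.
            set (y := PSeries d (exp (- lam))) in *.
            set (z := PSeries d (exp (- lam) ^ 2)) in *.
            rewrite exp_Ropp in Hrec.
            transitivity (D3 * exp lam * (1 * / exp lam * z)); [field; lra|].
            replace (1 * / exp lam * z)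
              with (y - - (D1 / D3) + D1 / D3 * / exp lam * y) by lra.
            field. lra. }
          rewrite HdC.
          replace (D3 * h D3 C lam * PSeries d (exp (- lam) ^ 2))
            with (h D3 C lam * (D3 * PSeries d (exp (- lam) ^ 2))) by ring.
          rewrite HdD. replace (exp (2 * lam)) with (exp lam * exp lam)
            by (rewrite <- exp_plus; f_equal; ring).
          ring. }
        rewrite HF2, Rabs_mult, (Rabs_pos_eq (D1 + _)) by lra.
        apply Rmult_le_compat_r; [apply Rabs_pos|lra].
      - intros lam Hlam. destruct (HL lam Hlam) as (Hpos & He2 & Hx & HBx).
        destruct (PSeries_dyadic_rec_bound c _ _ B (exp (- lam)) Hip Hq0 HCr)
          as [_ Hc]; try assumption.
        destruct (PSeries_dyadic_rec_bound d _ _ B (exp (- lam)) Rle_0_1 Hq0 HDr)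
          as [_ Hd]; try assumption.
        destruct (h_bounds D1 D2 D3 C lam) as [Hh1 Hh2]; try assumption.
        unfold F. unfold Rminus at 1.
        eapply Rle_trans; [apply Rabs_triang|].
        apply Rplus_le_compat.
        + apply Rabs_le. lra.
        + rewrite Rabs_Ropp. eapply Rle_trans; [apply Rabs_triang|].
          apply Rplus_le_compat; [exact Hc|].
          rewrite Rabs_mult, (Rabs_pos_eq (h D3 C lam)) by lra.
          apply Rmult_le_compat; [lra|apply Rabs_pos|lra|exact Hd]. }
    intros lam Hlam. rewrite (HS lam Hlam).
    specialize (HF lam Hlam). unfold F, h in *. lra.
  (* The factor 2 is the uniform bound on [h]. *)
  - apply (CVU_dom_M_test _ _ (Rabs (c O) + 2 * Rabs (d O))).
    intros lam k Hlam. destruct (HL lam Hlam) as (Hpos & He2 & Hx & HBx).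
    rewrite Hterm.
    destruct (h_bounds D1 D2 D3 C lam) as [_ Hh]; try assumption.
    pose proof (dyadic_rec_term_bound c _ _ B (exp (- lam)) Hip Hq0 HCr HB1 HBC Hx HBx k).
    pose proof (dyadic_rec_term_bound d _ _ B (exp (- lam)) Rle_0_1 Hq0 HDr
      HB1 HB2 Hx HBx k).
    eapply Rle_trans; [apply Rabs_triang|].
    rewrite (Rmult_plus_distr_r (Rabs (c O))). apply Rplus_le_compat; [assumption|].
    rewrite Rabs_mult, (Rabs_pos_eq (h D3 C lam)), Rmult_assoc by lra.
    apply Rmult_le_compat; [lra|apply Rabs_pos|lra|assumption].
Qed.
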